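(* There exists a nonprincipal ultrafilter $\mathcal{F}^*$ on $\mathbb{N}$ such that the map $\Phi_{\mathcal{F}^*}:\mathcal{D}_{\mathrm{co}}\to {}^*\mathbb{R}=\mathbb{R}^{\mathbb{N}}/\mathcal{F}^*$, $\mu\mapsto [s(\mu)]$, is not injective, even when restricted to $\{\mu\in\mathcal{D}_{\mathrm{co}} \mid \mu \text{ has a } C^\infty \text{ density with respect to Lebesgue measure}\}$.
   Context: $\mathbb{N}$ is the set of natural numbers including $0$. $\mathcal{D}_{\mathrm{co}}$ is the set of finite positive Borel measures $\mu$ on $[0,\infty)$ for which there exist $0<a<b<\infty$ with $\operatorname{supp}\mu\subset[a,b]$. For $\mu\in\mathcal{D}_{\mathrm{co}}$ the moments are $s_k(\mu)=\int_0^\infty t^k\,d\mu(t)$, $k\in\mathbb{N}$, and $s(\mu)=(s_k(\mu))_{k\in\mathbb{N}}$ is the moment sequence. Given a nonprincipal ultrafilter $\mathcal{F}^*$ on $\mathbb{N}$, the hyperreal numbers are ${}^*\mathbb{R}=\mathbb{R}^{\mathbb{N}}/\mathcal{F}^*$, where two sequences $r,t\in\mathbb{R}^{\mathbb{N}}$ define the same class, $[r]=[t]$, if and only if $\{n\in\mathbb{N}\mid t_n=r_n\}\in\mathcal{F}^*$. $C^\infty$ densities are understood as $C^\infty$ functions on $\mathbb{R}$. *)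

(* Defs.v *)
From HB Require Import structures.
From mathcomp Require Import all_boot all_order all_algebra generic_quotient.
From mathcomp Require Import all_classical all_reals all_analysis.
Import Order.TTheory GRing.Theory Num.Theory.
Import numFieldNormedType.Exports.

Set Implicit Arguments.
Unset Strict Implicit.
Unset Printing Implicit Defensive.

Local Open Scope classical_set_scope.
Local Open Scope ring_scope.

Definition nonprincipal (T : Type) (F : set_system T) : Prop :=
  forall x : T, F <> principal_filter x.

Section Hyperreals.
Variables (R : realType) (F : set_system nat).
Context {FF : UltraFilter F}.

Definition ultra_eq (r t : nat -> R) : bool := `[< F [set n | t n = r n] >].

Lemma ultra_eq_equiv : equiv_class_of ultra_eq.
Proof.
split.
- by move=> r; apply/asboolP; apply: filterS filterT.
- move=> r t; apply/asboolP/asboolP; by apply: filterS => n /= ->.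
- move=> r s t /asboolP sr /asboolP rt; apply/asboolP.
  by apply: filterS2 sr rt => n /= -> ->.
Qed.

Canonical ultra_eq_equivrel := EquivRelPack ultra_eq_equiv.

(* Only the underlying set of the ultrapower is needed, not its field
   structure. *)
Definition hyperreal : Type := {eq_quot ultra_eq}%qT.

Definition hyperclass (r : nat -> R) : hyperreal := (\pi_{eq_quot ultra_eq} r)%qT.

Lemma hyperclassP (r t : nat -> R) :
  hyperclass r = hyperclass t <-> F [set n | t n = r n].
Proof.
rewrite /hyperclass; split.
- by move=> /eqP; rewrite eqmodE => /asboolP.
- by move=> h; apply/eqP; rewrite eqmodE; apply/asboolP.
Qed.

End Hyperreals.
Arguments hyperreal R F {FF}.
Arguments hyperclass {R} F {FF} r.

Section Measures.
Variable R : realType.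

Notation borel_measure := {finite_measure set (measurableTypeR R) -> \bar R}.

(* A term of type [borel_measure] is a function on all subsets of [R], its
   values on non-Borel sets being irrelevant junk; equality of measures is
   therefore equality on Borel sets, not Leibniz equality. *)
Definition same_measure (mu nu : borel_measure) : Prop :=
  forall A : set (measurableTypeR R), measurable A -> mu A = nu A.

Definition support (mu : borel_measure) : set R :=
  [set x | forall U : set R, open_nbhs x U -> (0 < mu U)%E].

(* A measure on the half-line is encoded as a measure on [R] that does not
   charge the negative half-line. *)
Definition Dco : set borel_measure :=
  [set mu : borel_measure | mu [set x : R | x < 0] = 0%E /\
     exists a b : R, [/\ 0 < a, a < b & support mu `<=` `[a, b]]].

Definition moment (mu : borel_measure) (k : nat) : R :=
  \int[mu]_(t in `[0%R, +oo[) (t ^+ k).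

Definition Phi (F : set_system nat) {FF : UltraFilter F} (mu : borel_measure) :
  hyperreal R F := hyperclass F (moment mu).

Definition injective_on (Y : Type) (D : set borel_measure)
    (f : borel_measure -> Y) : Prop :=
  forall mu nu, D mu -> D nu -> f mu = f nu -> same_measure mu nu.

Definition smooth (f : R -> R) : Prop :=
  forall (n : nat) (x : R), derivable (f^`(n))%classic x 1.

Definition has_density (mu : borel_measure) (f : R -> R) : Prop :=
  (forall x, 0 <= f x) /\
  forall A : set (measurableTypeR R), measurable A ->
    mu A = (\int[lebesgue_measure]_(x in A) (f x)%:E)%E.

Definition has_smooth_density : set borel_measure :=
  [set mu : borel_measure | exists2 f : R -> R, smooth f & has_density mu f].

End Measures.
Arguments Phi {R} F {FF} mu.

(* Main.v *)
From HB Require Import structures.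
Require Import Defs.
From mathcomp Require Import all_boot all_order all_algebra ring lra.
From mathcomp Require Import all_classical all_reals all_analysis.
From mathcomp Require Import measurable_realfun.
Import Order.TTheory GRing.Theory Num.Theory.
Import numFieldNormedType.Exports.

Set Implicit Arguments.
Unset Strict Implicit.
Unset Printing Implicit Defensive.

Local Open Scope classical_set_scope.
Local Open Scope ring_scope.

(** Equality of two classes in the ultrapower only asks for equality of the
moments on one set of the ultrafilter, and every infinite subset of nat belongs
to some nonprincipal ultrafilter ([ultrafilter_along]).  So it is enough to find
two different measures, with smooth densities supported in the same compact
subset of the open half-line, whose k-th moments agree for infinitely many k
([equal_sparse_moments]).

The difference of the two densities will be a nonzero smooth function g whose
moments of orders k_0, k_1, ... all vanish.  To kill a single moment of a
function f, subtract a dilate of it: for 0 < r < 1,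
  int t^k f(r t) dt = r^-(k+1) int t^k f(t) dt
([truncated_moment_dilation]), so f(t) - r^(k+1) f(r t) has vanishing k-th
moment.  The same identity shows that the operation multiplies every other
moment by a constant, so that moments that vanish already stay zero.  Iterate
from a bump psi on [1, 2], at step j with r = r_j and k = k_j.  If the product of
the r_j stays above 1/2, all iterates are supported in [1, 4].  If, r_j being
given, k_j is taken so large that r_j^(k_j+1) <= 4^-(j+1), the iterates converge
and their derivatives of each order are bounded uniformly.  This is all that is
needed for the limit g to be smooth ([smooth_dilate_lim]), and then its k_j-th
moments vanish by dominated convergence ([sparse_vanishing_moments]).  Moreover
g differs from psi by at most 2/3 of the maximum of psi, so g is positive where
psi is maximal.

Finally, g is signed, but if chi is a smooth bump that is positive on the support
of g, then for a large constant C both g + C chi and C chi are nonnegative, and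
they are the required densities. *)

(** * Smooth functions *)

Section SmoothFunctions.
Variable R : realType.
Implicit Types (f g : R -> R) (x a b : R).

(** Smoothness as a greatest fixed point: no formula for the n-th derivative is
needed, only a class of functions that contains the derivatives of its
members. *)
Lemma smooth_closed_class (A : set (R -> R)) :
  (forall f, A f -> (forall x, derivable f x 1) /\ A f^`()%classic) ->
  A `<=` @smooth R.
Proof.
move=> A1 f Af n x; suff /A1[+ _] : A (f^`(n))%classic by [].
elim: n => [//|n IH]; rewrite derive1nS; exact: (A1 _ IH).2.
Qed.

Lemma smooth_derivable f x : smooth f -> derivable f x 1.
Proof. by move=> /(_ 0 x). Qed.

Lemma smooth_derive1 f : smooth f -> smooth f^`()%classic.
Proof. by move=> sf n x; have := sf n.+1 x; rewrite derive1Sn. Qed.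

Lemma smooth_derive1n f n : smooth f -> smooth f^`(n)%classic.
Proof.
by move=> sf; elim: n => [//|n IH]; rewrite derive1nS; exact: smooth_derive1.
Qed.

Lemma smooth_continuous f : smooth f -> continuous f.
Proof.
by move=> sf x; apply/differentiable_continuous/derivable1_diffP/smooth_derivable.
Qed.

Lemma smooth_is_derive f n x :
  smooth f -> is_derive x 1 (f^`(n))%classic (f^`(n.+1)%classic x).
Proof.
move=> sf; rewrite derive1nS derive1E.
by apply: derivableP; exact: sf.
Qed.

Lemma smooth_tower (D : nat -> R -> R) :
  (forall n x, is_derive x 1 (D n) (D n.+1 x)) -> smooth (D 0%N).
Proof.
move=> DD; apply: (@smooth_closed_class (range D)); last by exists 0%N.
move=> _ [n _ <-]; split=> [x|]; first exact: ex_derive.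
by exists n.+1 => //; apply/funext => x; rewrite derive1E derive_val.
Qed.

(** Products of smooth functions do not form a class closed under
differentiation, since the product rule yields a sum; the algebra that smooth
functions generate is such a class, which avoids the general Leibniz formula. *)
Inductive smooth_gen : (R -> R) -> Prop :=
| SmoothGenBase f : smooth f -> smooth_gen f
| SmoothGenD f g : smooth_gen f -> smooth_gen g -> smooth_gen (f + g)
| SmoothGenM f g : smooth_gen f -> smooth_gen g -> smooth_gen (f * g).

Lemma smooth_gen_smooth f : smooth_gen f -> smooth f.
Proof.
move: f; apply: smooth_closed_class => f.
elim=> [{}f sf|{}f g _ [df f'] _ [dg g']|{}f g gf [df f'] gg [dg g']]; split.
- by move=> x; exact: smooth_derivable.
- exact/SmoothGenBase/smooth_derive1.
- by move=> x; exact: derivableD.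
- rewrite (_ : _^`()%classic = derive1 f + derive1 g); first exact: SmoothGenD.
  by apply/funext => x; rewrite !fctE !derive1E deriveD.
- by move=> x; exact: derivableM.
- rewrite (_ : _^`()%classic = f * derive1 g + g * derive1 f).
    by apply: SmoothGenD; exact: SmoothGenM.
  by apply/funext => x; rewrite !fctE !derive1E deriveM.
Qed.

Lemma smoothD f g : smooth f -> smooth g -> smooth (f + g).
Proof.
by move=> sf sg; apply/smooth_gen_smooth/SmoothGenD; exact: SmoothGenBase.
Qed.

Lemma smoothM f g : smooth f -> smooth g -> smooth (f * g).
Proof.
by move=> sf sg; apply/smooth_gen_smooth/SmoothGenM; exact: SmoothGenBase.
Qed.

Lemma is_derive_affine f a b x d : is_derive (a * x + b) 1 f d ->
  is_derive x 1 (fun y => f (a * y + b)) (a * d).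
Proof.
move=> fd; have ab : is_derive x 1 (fun y : R => a * y + b) a.
  by apply: is_derive_eq; rewrite addr0 scaler1.
by rewrite mulrC; exact: (is_derive1_comp (g := fun y : R => a * y + b)).
Qed.

Lemma smooth_affine f a b : smooth f -> smooth (fun x => f (a * x + b)).
Proof.
move=> sf.
pose D n x : R := a ^+ n * f^`(n)%classic (a * x + b).
have -> : (fun x => f (a * x + b)) = D 0%N.
  by apply/funext => x; rewrite /D mul1r.
apply: smooth_tower => n x.
rewrite /D exprSr -mulrA.
apply: (is_deriveZ (f := fun x => f^`(n)%classic (a * x + b))).
apply: is_derive_affine; exact: smooth_is_derive.
Qed.

Lemma smoothZ f a : smooth f -> smooth (fun x => a * f x).
Proof.
move=> sf.
pose D n x : R := a * f^`(n)%classic x.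
apply: (@smooth_tower D) => n x.
apply: (is_deriveZ (f := f^`(n)%classic)); exact: smooth_is_derive.
Qed.

(** A first order expansion with a quadratic error is stable under pointwise
limits and easy to check at the singular point of a flat function; this is how
both kinds of derivative below are obtained. *)
Lemma is_derive_quadratic_error f x d (C : R) :
  (forall h, `|f (h + x) - f x - h * d| <= C * h ^+ 2) -> is_derive x 1 f d.
Proof.
move=> fC.
suff fd : h^-1 *: ((f \o shift x) (h *: 1) - f x) @[h --> 0^'] --> d.
  by apply: DeriveDef; [apply: cvgP fd | apply/cvg_lim].
have C0 : 0 <= C by have := fC 1; rewrite expr1n mulr1; apply: le_trans.
apply/cvgrPdist_le => e e0.
have C1 : 0 < C + 1 by lra.
near=> h.
have h0 : h != 0 by near: h; exact: nbhs_dnbhs_neq.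
have hn : 0 < `|h| by rewrite normr_gt0.
have he : `|h| <= e / (C + 1).
  near: h; apply: dnbhs0_le; exact: divr_gt0.
rewrite /= /GRing.scale/= mulr1 distrC -(ler_pM2l hn) -normrM.
rewrite (_ : h * _ = f (h + x) - f x - h * d); last by field.
rewrite (le_trans (fC h))// -(real_normK (num_real h)) expr2.
by rewrite mulrCA ler_pM2l//; move: he; rewrite ler_pdivlMr//; nra.
Unshelve. all: by end_near. Qed.

(** * A flat function and smooth bumps *)

(** Induction on n, with the exponential of y written as the square of that of
y / 2: one factor absorbs the power of order n, the other one the extra y. *)
Lemma exprn_le_expR n : exists C : R, forall y, 0 <= y -> y ^+ n <= C * expR y.
Proof.
elim: n => [|n [C IH]].
  by exists 1 => y y0; rewrite mul1r expr0; have := expR_ge1Dx y; lra.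
exists (2 ^+ n.+1 * C) => y y0.
have z0 : 0 <= y / 2 by rewrite divr_ge0.
have -> : y ^+ n.+1 = 2 ^+ n.+1 * ((y / 2) ^+ n * (y / 2)).
  by rewrite -exprSr -exprMn mulrC divfK.
have -> : expR y = expR (y / 2) * expR (y / 2) by rewrite -expRD -splitr.
rewrite -mulrA ler_pM2l ?exprn_gt0// [leRHS]mulrA.
apply: ler_pM => //; [exact: exprn_ge0|exact: IH|].
by have := expR_ge1Dx (y / 2); lra.
Qed.

Lemma horner_le_expR (p : {poly R}) :
  exists C : R, forall y, 0 <= y -> `|p.[y]| <= C * expR y.
Proof.
have /(_ _)/cid-/all_sig[C yC] := exprn_le_expR.
exists (\sum_(i < size p) `|p`_i| * C i) => y y0.
rewrite horner_coef mulr_suml (le_trans (ler_norm_sum _ _ _))//.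
apply: ler_sum => i _.
by rewrite normrM normrX (ger0_norm y0) -mulrA ler_wpM2l// yC.
Qed.

(** The function exp(-1/x), extended by zero to x <= 0, is the case p = 1; the
polynomial factor makes the family closed under differentiation. *)
Definition flat (p : {poly R}) x : R :=
  if 0 < x then p.[x^-1] * expR (- x^-1) else 0.

(** Away from 0 this is calculus.  At 0, the absolute value of [flat p h] is at
most a constant times h^2, because with y = 1/h the quantity y^2 p(y) exp(- y) is bounded. *)
Lemma is_derive_flat (p : {poly R}) x :
  is_derive x 1 (flat p) (flat ('X^2 * (p - p^`())) x).
Proof.
have [x0|x0|->] := ltgtP x 0.
- have -> : flat ('X^2 * (p - p^`())) x = 0 by rewrite /flat lt_gtF.
  apply: (near_eq_is_derive (f := cst 0)).
  near=> y; rewrite /flat lt_gtF//.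
  by near: y; exact: lt_nbhsl.
- apply: (near_eq_is_derive (f := fun x => p.[x^-1] * expR (- x^-1))).
    near=> y; rewrite /flat ifT//.
    by near: y; exact: lt_nbhsr.
  have dV : is_derive x 1 (fun x : R => x^-1) (- x^-2).
    have := @is_deriveV R id x 1 1 (lt0r_neq0 x0) (is_derive_id _ _).
    by rewrite /GRing.scale/= mulr1.
  have dp := is_derive1_comp (is_derive_poly p x^-1) dV.
  have dN : is_derive x 1 (fun x : R => - x^-1) (- - x^-2) by exact: is_deriveN.
  have de := is_derive1_comp (g := fun x : R => - x^-1)
    (is_derive_expR (- x^-1)) dN.
  have := is_deriveM dp de.
  rewrite /flat x0 !hornerE.
  move=> /is_derive_eq; apply.
  by rewrite /GRing.scale/= exprVn; ring.
- rewrite {2}/flat ltxx.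
  have [C pC] := horner_le_expR ('X^2 * p).
  apply: (@is_derive_quadratic_error _ _ _ C) => h.
  rewrite addr0 mulr0 subr0 {2}/flat ltxx subr0.
  have C0 : 0 <= C.
    by have := pC 0 (lexx _); rewrite expR0 mulr1; apply: le_trans.
  rewrite /flat; case: ifPn => [h0|_]; last by rewrite normr0 mulr_ge0// sqr_ge0.
  have := pC h^-1; rewrite invr_ge0 (ltW h0) => /(_ isT).
  rewrite hornerM hornerXn normrM normrX gtr0_norm ?invr_gt0//.
  rewrite [in X in _ -> X]normrM (ger0_norm (expR_ge0 _)) expRN.
  by rewrite -ler_pdivrMr ?expR_gt0// exprVn -mulrA mulrC ler_pdivrMr ?exprn_gt0.
Unshelve. all: by end_near. Qed.

Lemma smooth_flat : smooth (flat 1).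
Proof.
pose P n := iter n (fun p : {poly R} => 'X^2 * (p - p^`())) 1.
apply: (@smooth_tower (fun n => flat (P n))) => n x.
exact: is_derive_flat.
Qed.

Definition bump_on a b x : R := flat 1 (x - a) * flat 1 (b - x).

Lemma flat1E x : flat 1 x = if 0 < x then expR (- x^-1) else 0.
Proof. by rewrite /flat hornerC mul1r. Qed.

Lemma flat1_ge0 x : 0 <= flat 1 x.
Proof. by rewrite flat1E; case: ifP => // _; exact: expR_ge0. Qed.

Lemma smooth_bump_on a b : smooth (bump_on a b).
Proof.
have -> : bump_on a b =
  (fun x => flat 1 (1 * x + - a)) * (fun x => flat 1 (-1 * x + b)).
  by apply/funext => x; rewrite /bump_on !fctE mul1r mulN1r (addrC (- x)).
by apply: smoothM; apply: smooth_affine; exact: smooth_flat.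
Qed.

Lemma bump_on_ge0 a b x : 0 <= bump_on a b x.
Proof. by rewrite mulr_ge0// flat1_ge0. Qed.

Lemma bump_on_gt0 a b x : a < x < b -> 0 < bump_on a b x.
Proof.
by move=> /andP[ax xb]; rewrite /bump_on !flat1E !subr_gt0 ax xb mulr_gt0 ?expR_gt0.
Qed.

Lemma bump_on_eq0 a b x : ~~ (a < x < b) -> bump_on a b x = 0.
Proof.
rewrite negb_and /bump_on !flat1E !subr_gt0.
by move=> /orP[/negPf ->|/negPf ->]; rewrite ?mul0r ?mulr0.
Qed.

(** * Derivatives of pointwise limits *)

(** The mean value theorem without an order between the two points, as needed
for increments h of either sign. *)
Lemma MVT_unordered f (df : R -> R) x y : (forall z : R, is_derive z 1 f (df z)) ->
  exists2 c, `|c - x| <= `|y - x| & f y - f x = df c * (y - x).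
Proof.
move=> fdf.
have cf A : {within A, continuous f}.
  apply: continuous_subspaceT => z.
  exact/differentiable_continuous/derivable1_diffP/ex_derive.
have [xy|/ltW yx] := leP x y.
  have [c + ->] := MVT_segment xy (fun z _ => fdf z) (cf _).
  rewrite in_itv/= => /andP[xc cy]; exists c => //.
  by rewrite !ger0_norm ?subr_ge0// lerB.
have [c + fc] := MVT_segment yx (fun z _ => fdf z) (cf _).
rewrite in_itv/= => /andP[yc cx]; exists c.
  by rewrite !ler0_norm ?subr_le0// lerN2 lerB.
by rewrite -opprB fc -mulrN opprB.
Qed.

Lemma taylor1_error f (df ddf : R -> R) (K x h : R) :
  (forall z : R, is_derive z 1 f (df z)) -> (forall z : R, is_derive z 1 df (ddf z)) ->
  (forall z, `|ddf z| <= K) -> `|f (h + x) - f x - h * df x| <= K * h ^+ 2.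
Proof.
move=> fdf dfddf ddfK.
have [c + ->] := MVT_unordered x (h + x) fdf; rewrite addrK => ch.
rewrite [df c * h]mulrC -mulrBr.
have [e _ ->] := MVT_unordered x c dfddf.
rewrite !normrM -(real_normK (num_real h)) expr2 mulrCA.
by apply: ler_pM => //; apply: ler_wpM2l.
Qed.

(** Pointwise convergence of the functions and of their derivatives is enough
here, because the bound on the second derivatives makes the error term of the
first order expansion uniform in j. *)
Lemma is_derive_lim (f df ddf : nat -> R -> R) (F dF : R -> R) (K : R) :
  (forall j (x : R), is_derive x 1 (f j) (df j x)) ->
  (forall j (x : R), is_derive x 1 (df j) (ddf j x)) ->
  (forall j x, `|ddf j x| <= K) ->
  (forall x, f j x @[j --> \oo] --> F x) ->
  (forall x, df j x @[j --> \oo] --> dF x) ->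
  forall x : R, is_derive x 1 F (dF x).
Proof.
move=> fdf dfddf ddfK fF dfdF x.
apply: (is_derive_quadratic_error (C := K)) => h.
have cv : `|f j (h + x) - f j x - h * df j x| @[j --> \oo] -->
          `|F (h + x) - F x - h * dF x|.
  by apply: cvg_norm; apply: cvgB; [exact: cvgB|exact: cvgMr].
apply: (cvgr_to_le cv); near=> j.
exact: (taylor1_error x h (fdf j) (dfddf j) (ddfK j)).
Unshelve. all: by end_near. Qed.

Lemma derive1n_eq0_outside f a b n : (forall x, x \notin `[a, b] -> f x = 0) ->
  forall x, x \notin `[a, b] -> f^`(n)%classic x = 0.
Proof.
move=> f0; elim: n => [//|n IH] x xab.
rewrite derive1nS derive1E.
suff /near_eq_derive -> : \near x, f^`(n)%classic x = cst 0 x by rewrite derive_cst.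
move: xab; rewrite in_itv/= negb_and -!ltNge => /orP[xa|bx].
  near=> y; apply: IH; rewrite in_itv/= negb_and -!ltNge; apply/orP; left.
  by near: y; exact: lt_nbhsl.
near=> y; apply: IH; rewrite in_itv/= negb_and -!ltNge; apply/orP; right.
by near: y; exact: lt_nbhsr.
Unshelve. all: by end_near. Qed.

Lemma smooth_compact_bounded f a b n : a <= b -> smooth f ->
  (forall x, x \notin `[a, b] -> f x = 0) ->
  exists M : R, forall x, `|f^`(n)%classic x| <= M.
Proof.
move=> ab sf f0.
have cf : continuous (fun x => `|f^`(n)%classic x|).
  by move=> x; apply: cvg_norm; exact: (smooth_continuous (smooth_derive1n sf)).
have [c _ cmax] := EVT_max ab (continuous_subspaceT cf).
exists `|f^`(n)%classic c| => x; have [xab|xab] := boolP (x \in `[a, b]).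
  exact: cmax.
by rewrite (derive1n_eq0_outside _ f0)// normr0.
Qed.

End SmoothFunctions.

(** * Iterated differences of dilates *)

Section DilationDifferences.
Variables (R : realType) (r : nat -> R).
Hypothesis r_gt0 : forall j, 0 < r j.
Hypothesis r_le1 : forall j, r j <= 1.
Implicit Types (c : nat -> R) (f : R -> R) (x M : R) (j n : nat).

(** The iterates of the construction: step i subtracts [c i] times the dilate
of ratio [r i].  The coefficients are a parameter because differentiation keeps
this form, with [c i] replaced by [c i * r i]. *)
Fixpoint dilate c f j : R -> R :=
  if j is i.+1 then fun x => dilate c f i x - c i * dilate c f i (r i * x)
  else f.

Lemma is_derive_dilate c f df : (forall x, is_derive x 1 f (df x)) ->
  forall j x, is_derive x 1 (dilate c f j) (dilate (fun i => c i * r i) df j x).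
Proof.
move=> fdf; elim=> [|j IH] x /=; first exact: fdf.
apply: (@is_deriveB _ _ _ (dilate c f j) (fun x => c j * dilate c f j (r j * x))).
rewrite -mulrA; apply: (is_deriveZ (f := fun x => dilate c f j (r j * x))).
have := @is_derive_affine _ (dilate c f j) (r j) 0 x.
under eq_fun do rewrite addr0.
by rewrite addr0; apply.
Qed.

(** The rate is such that the corrections add up to less than the sup norm of
the initial function, which keeps the limit away from zero. *)
Definition fast_decay c := forall j, `|c j| <= 4^-1 ^+ j.+1.

(** If f is bounded by M, then all iterates are bounded by 2 M, so step i moves
the function by at most 2 M / 4^(i+1); the right-hand side is the sum of these
bounds over i < j. *)
Lemma dilate_dist c f M j x : fast_decay c -> (forall y, `|f y| <= M) ->
  `|dilate c f j x - f x| <= 2 / 3 * (1 - 4^-1 ^+ j) * M.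
Proof.
move=> hc fM; have M0 : 0 <= M by apply: le_trans (fM 0).
elim: j x => [|j IH] x; first by rewrite expr0 !subrr normr0 mulr0 mul0r.
have q0 : 0 <= (4^-1 : R) ^+ j by rewrite exprn_ge0.
have D2 y : `|dilate c f j y| <= 2 * M.
  rewrite -(subrK (f y) (dilate c f j y)) (le_trans (ler_normD _ _))//.
  by have := IH y; have := fM y; nra.
have cD : `|c j * dilate c f j (r j * x)| <= 4^-1 ^+ j.+1 * (2 * M).
  by rewrite normrM ler_pM.
rewrite /= addrAC (le_trans (ler_normB _ _))//.
move: cD (IH x); rewrite exprSr; nra.
Qed.

Lemma dilate_bound c f M j x : fast_decay c -> (forall y, `|f y| <= M) ->
  `|dilate c f j x| <= 2 * M.
Proof.
move=> hc fM; rewrite -(subrK (f x) (dilate c f j x)).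
have M0 : 0 <= M by apply: le_trans (fM 0).
have q0 : 0 <= (4^-1 : R) ^+ j by rewrite exprn_ge0.
rewrite (le_trans (ler_normD _ _))//.
by have := dilate_dist j x hc fM; have := fM x; nra.
Qed.

Lemma cvg_dilate c f M x : fast_decay c -> (forall y, `|f y| <= M) ->
  cvgn (fun j => dilate c f j x).
Proof.
move=> hc fM; have M0 : 0 <= M by apply: le_trans (fM 0).
have -> : (fun j => dilate c f j x) =
    cst (f x) + series (telescope (fun j => dilate c f j x)).
  by apply/funext => j; exact: (eq_sum_telescope (fun j => dilate c f j x)).
apply: is_cvgD; first exact: is_cvg_cst.
apply: normed_cvg; apply: (@series_le_cvg _ _ (geometric (2 * M) 4^-1)) => //.
- by move=> j; exact: normr_ge0.
- by move=> j; rewrite /geometric/= mulr_ge0 ?mulr_ge0// exprn_ge0.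
- move=> j; rewrite /telescope/= addrAC subrr add0r normrN normrM.
  rewrite /geometric/= mulrC; apply: ler_pM => //; first exact: dilate_bound.
  by rewrite (le_trans (hc j))// exprS ler_piMl ?exprn_ge0//; lra.
- by apply: is_cvg_geometric_series; rewrite ger0_norm; lra.
Qed.

Definition dilate_lim c f x : R := limn (fun j => dilate c f j x).

Lemma dilate_limP c f M x : fast_decay c -> (forall y, `|f y| <= M) ->
  dilate c f j x @[j --> \oo] --> dilate_lim c f x.
Proof. by move=> hc fM; exact: cvg_dilate fM. Qed.

Lemma dilate_lim_dist c f M x : fast_decay c -> (forall y, `|f y| <= M) ->
  `|dilate_lim c f x - f x| <= 2 / 3 * M.
Proof.
move=> hc fM; have M0 : 0 <= M by apply: le_trans (fM 0).
have cv : `|dilate c f j x - f x| @[j --> \oo] --> `|dilate_lim c f x - f x|.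
  by apply: cvg_norm; apply: cvgB; [exact: dilate_limP fM|exact: cvg_cst].
apply: (cvgr_to_le cv); near=> j.
have q0 : 0 <= (4^-1 : R) ^+ j by rewrite exprn_ge0.
by rewrite (le_trans (dilate_dist j x hc fM))//; nra.
Unshelve. all: by end_near. Qed.

Lemma fast_decayM c : fast_decay c -> fast_decay (fun i => c i * r i).
Proof.
move=> hc j; rewrite normrM (le_trans _ (hc j))// ler_piMr// ger0_norm//.
exact: ltW.
Qed.

(** The n-th derivatives of the iterates are the iterates that start from the
n-th derivative of f with the smaller coefficients [c i * r i ^+ n]. *)
Lemma smooth_dilate_lim c f : smooth f -> fast_decay c ->
  (forall n, exists M, forall x, `|f^`(n)%classic x| <= M) ->
  smooth (dilate_lim c f).
Proof.
move=> sf hc /(_ _)/cid-/all_sig[M fM].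
pose cn n i := c i * r i ^+ n.
have cnS n : cn n.+1 = (fun i => cn n i * r i).
  by apply/funext => i; rewrite /cn exprSr mulrA.
have hcn n : fast_decay (cn n).
  elim: n => [j|n IH]; first by rewrite /cn expr0 mulr1.
  by rewrite cnS; exact: fast_decayM.
have cn0 : cn 0%N = c by apply/funext => i; rewrite /cn mulr1.
rewrite -cn0; apply: (@smooth_tower _ (fun n => dilate_lim (cn n) f^`(n)%classic)).
move=> n; pose D n j := dilate (cn n) f^`(n)%classic j.
have DD m j x : is_derive x 1 (D m j) (D m.+1 j x).
  by rewrite /D cnS; apply: is_derive_dilate => y; exact: smooth_is_derive.
apply: (is_derive_lim (DD n) (DD n.+1) (K := 2 * M n.+2)).
- by move=> j x; exact: dilate_bound.
- by move=> x; exact: dilate_limP (fM n).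
- by move=> x; exact: dilate_limP (fM n.+1).
Qed.

Lemma smooth_dilate c f j : smooth f -> smooth (dilate c f j).
Proof.
move=> sf; elim: j => [//|j IH] /=.
have -> : (fun x => dilate c f j x - c j * dilate c f j (r j * x)) =
    dilate c f j + (fun x => - c j * (dilate c f j (r j * x + 0))).
  by apply/funext => x; rewrite !fctE addr0 mulNr.
by apply: smoothD => //; apply: smoothZ; exact: smooth_affine.
Qed.

(** A dilation of ratio [r j <= 1] stretches the support away from zero: the
left end is preserved and the right end grows by the factor [(r j)^-1]. *)
Lemma dilate_eq0 c f a b j : 0 <= a -> 0 <= b ->
  (forall x, x \notin `[a, b] -> f x = 0) ->
  forall x, x \notin `[a, b / \prod_(i < j) r i] -> dilate c f j x = 0.
Proof.
move=> a0 b0 f0; elim: j => [|j IH] x; first by rewrite big_ord0 divr1; exact: f0.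
set s := \prod_(i < j) r i in IH.
have s0 : 0 < s by exact: prodr_gt0.
rewrite big_ord_recr/= -/s => xab.
have xs y : (b / s < y) = (b < s * y) by rewrite ltr_pdivrMr// mulrC.
have xsr y : (b / (s * r j) < y) = (b < s * (r j * y)).
  by rewrite ltr_pdivrMr ?mulr_gt0// mulrC mulrA.
move: xab; rewrite in_itv/= negb_and -!ltNge xsr => xab.
have rx0 := r_gt0 j; have rx1 := r_le1 j.
rewrite !IH ?mulr0 ?subr0// in_itv/= negb_and -!ltNge xs.
  by case/orP : xab => [xa|->]; rewrite ?orbT//; apply/orP; left; nra.
case/orP : xab => [->//|bx]; apply/orP; right.
rewrite (lt_le_trans bx)// ler_pM2l//.
have : 0 < s * (r j * x) by rewrite (le_lt_trans b0).
by rewrite pmulr_rgt0// pmulr_rgt0// => x0; nra.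
Qed.

End DilationDifferences.

(** * Moments of continuous functions on a segment *)

Section Moments.
Variable R : realType.
Local Notation lambda := (@lebesgue_measure R).
Implicit Types (f g : R -> R) (b B r : R) (k j : nat).

(** Restricting the moment to a segment makes every continuous function
integrable; for the functions of interest, which vanish beyond B, it is the
whole moment on the half-line. *)
Definition truncated_moment B k f : R :=
  (\int[lambda]_(x in `[0%R, B]) (x ^+ k * f x))%R.

Lemma continuous_monomialM k f :
  continuous f -> continuous (fun x : R => x ^+ k * f x).
Proof.
by move=> cf x; apply: cvgM; [exact: exprn_continuous|exact: cf].
Qed.

Lemma integrable_monomialM B k f : continuous f ->
  lambda.-integrable `[0%R, B] (EFin \o (fun x : R => x ^+ k * f x)).
Proof.
move=> cf; apply: continuous_compact_integrable; first exact: segment_compact.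
exact/continuous_subspaceT/continuous_monomialM.
Qed.

(** Substitution y = r x.  It turns [0, B] into [0, r B], and the missing part
]r B, B] is where f vanishes. *)
Lemma truncated_moment_dilation B b r k f : continuous f ->
  0 < r -> 0 <= B -> b <= r * B -> r <= 1 -> (forall x, b < x -> f x = 0) ->
  r ^+ k.+1 * truncated_moment B k (fun x => f (r * x)) = truncated_moment B k f.
Proof.
move=> cf r0 B0 brB r1 f0.
have dF (x : R) : is_derive x 1 (fun y : R => r * y) r.
  by apply: is_derive_eq; rewrite scaler1.
have F'E : (fun y : R => r * y)^`()%classic = cst r.
  by apply/funext => x; rewrite derive1E derive_val.
have cF : continuous (fun y : R => r * y).
  by move=> x; exact/differentiable_continuous/derivable1_diffP.
have cfr : continuous (fun x : R => f (r * x)).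
  by move=> x; apply: continuous_comp; [exact: cF|exact: cf].
rewrite /truncated_moment -RintegralZl//; last exact: integrable_monomialM.
transitivity (\int[lambda]_(x in `[(r * 0)%R, (r * B)%R]) (x ^+ k * f x))%R.
  rewrite /Rintegral (@integration_by_substitution_increasing _ (fun y => r * y)
    (fun x => x ^+ k * f x) 0 B)//.
  - congr fine; apply: eq_integral => x _ /=.
    by rewrite !fctE F'E /= exprMn exprSr; congr EFin; ring.
  - by move=> x y _ _ xy; rewrite ltr_pM2l.
  - by rewrite F'E => x _; exact: cst_continuous.
  - by rewrite F'E; exact: is_cvg_cst.
  - by rewrite F'E; exact: is_cvg_cst.
  - split => [x _|/=|/=]; first exact: ex_derive.
    + by apply: cvg_at_right_filter; exact: cF.
    + by apply: cvg_at_left_filter; exact: cF.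
  - exact/continuous_subspaceT/continuous_monomialM.
rewrite mulr0 Rintegral_mkcond [RHS]Rintegral_mkcond.
congr Rintegral; apply/funext => x; rewrite !patchE !mem_setE !in_itv/=.
have [x0/=|//] := leP 0 x.
have [xrB|rBx] := leP x (r * B); first by rewrite ifT//; nra.
by case: ifP => // _; rewrite f0 ?mulr0//; exact: le_lt_trans rBx.
Qed.

Lemma truncated_momentB B k f g c : continuous f -> continuous g ->
  truncated_moment B k (fun x => f x - c * g x) =
  truncated_moment B k f - c * truncated_moment B k g.
Proof.
move=> cf cg; rewrite /truncated_moment.
rewrite -RintegralZl//; last exact: integrable_monomialM.
rewrite -RintegralB//.
- by apply: eq_Rintegral => x _; ring.
- exact: integrable_monomialM.
- rewrite (_ : _ \o _ = EFin \o (fun x => x ^+ k * (cst c * g) x)).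
    by apply: integrable_monomialM => x; apply: cvgM; [exact: cvg_cst|exact: cg].
  by apply/funext => x /=; congr EFin; rewrite !fctE; ring.
Qed.

Lemma cvg_truncated_moment B k (f : nat -> R -> R) (F : R -> R) (M : R) :
  0 <= B -> (forall j, continuous (f j)) -> continuous F ->
  (forall j x, `|f j x| <= M) -> (forall x, f j x @[j --> \oo] --> F x) ->
  truncated_moment B k (f j) @[j --> \oo] --> truncated_moment B k F.
Proof.
move=> B0 cf cF fM fF.
rewrite /truncated_moment /Rintegral; apply: fine_cvg; rewrite fineK; last first.
  exact: (integrable_fin_num _ (integrable_monomialM B k cF)).
apply: (@dominated_cvg _ _ _ lambda `[0%R, B]%classic (measurable_itv _)
  (fun j x => (x ^+ k * f j x)%:E) (fun x => (x ^+ k * F x)%:E)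
  (cst (B ^+ k * M)%:E)).
- by move=> j; exact: (measurable_int lambda (integrable_monomialM _ _ _)).
- move=> x _; apply: cvg_EFin; first by near=> j.
  by apply: cvgMr; exact: fF.
- by [].
- apply/integrableP; split; first exact: measurable_cst.
  rewrite integral_cst//= lebesgue_measure_itv/= ; case: ifPn => _.
    by rewrite ltry.
  by rewrite mule0.
- move=> j x; rewrite /= in_itv/= => /andP[x0 xB].
  rewrite lee_fin normrM normrX ger0_norm//.
  by apply: ler_pM => //; rewrite ?exprn_ge0// lerXn2r// nnegrE.
Unshelve. all: by end_near. Qed.

End Moments.

(** * A smooth function with infinitely many vanishing moments *)

Section SparseVanishingMoments.
Variable R : realType.

(** The quotient of two consecutive terms of the sequence
(j + 2) / (2 (j + 1)), which decreases strictly from 1 to 1/2; so the partial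
products are the terms of that sequence. *)
Definition ratio (j : nat) : R :=
  ((j%:R + 1) * (j%:R + 3)) / (j%:R + 2) ^+ 2.

Lemma ratio_gt0 j : 0 < ratio j.
Proof.
by have j0 : 0 <= j%:R :> R by []; rewrite divr_gt0 ?mulr_gt0 ?exprn_gt0//; lra.
Qed.

Lemma ratio_lt1 j : ratio j < 1.
Proof.
have j0 : 0 <= j%:R :> R by [].
by rewrite ltr_pdivrMr ?exprn_gt0//; nra.
Qed.

Lemma ratio_ge j : 2^-1 <= ratio j.
Proof.
have j0 : 0 <= j%:R :> R by [].
by rewrite ler_pdivlMr ?exprn_gt0//; nra.
Qed.

Lemma prod_ratio j : \prod_(i < j) ratio i = (j%:R + 2) / (2 * (j%:R + 1)).
Proof.
elim: j => [|j IH].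
  by rewrite big_ord0 add0r; field.
have j0 : 0 <= j%:R :> R by [].
rewrite big_ord_recr/= IH /ratio -natr1; field.
by rewrite !gt_eqF//; lra.
Qed.

Lemma prod_ratio_ge j : 2^-1 <= \prod_(i < j) ratio i.
Proof.
have j0 : 0 <= j%:R :> R by [].
by rewrite prod_ratio ler_pdivlMr; lra.
Qed.

Lemma exponent_exists j :
  exists k : nat, (j <= k)%N /\ ratio j ^+ k.+1 <= 4^-1 ^+ j.+1.
Proof.
have r0 := ltW (ratio_gt0 j).
have : `|ratio j| < 1 by rewrite ger0_norm ?ratio_lt1.
move=> /cvg_expr/cvgr_le /(_ (4^-1 ^+ j.+1)).
rewrite exprn_gt0 ?invr_gt0// => /(_ isT)[N _ Nr].
exists (maxn j N); rewrite leq_maxl; split => //.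
by apply: Nr => /=; rewrite leqW// leq_maxr.
Qed.

(** Applied to the bump on [1, 2] with [c j = ratio j ^+ (k j).+1], step j
annihilates the moment of order [k j] and later steps multiply it by constants;
so the moments of order [k i] of the iterates are eventually zero.  The bound
8 leaves room for the dilates, of ratio at least 1/2, of functions supported in
[1, 4]. *)
Lemma sparse_vanishing_moments : exists (k : nat -> nat) (g : R -> R) (M t : R),
  [/\ forall j, (j <= k j)%N, smooth g,
      forall x, x \notin `[1, 4] -> g x = 0, forall x, `|g x| <= M &
      0 < g t /\ forall j, truncated_moment 8 (k j) g = 0].
Proof.
have /(_ _)/cid-/all_sig[k /all_and2[jk rk]] := exponent_exists.
pose psi : R -> R := bump_on 1 2; pose c j := ratio j ^+ (k j).+1.
have r0 := ratio_gt0; have r1 j := ltW (ratio_lt1 j).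
have hc : fast_decay c by move=> j; rewrite ger0_norm; [exact: rk|exact/exprn_ge0/ltW].
have spsi : smooth psi by exact: smooth_bump_on.
have psi0 x : x \notin `[1, 2] -> psi x = 0.
  move=> x12; apply: bump_on_eq0; apply: contra x12 => /andP[x1 x2].
  by rewrite in_itv/= !ltW.
have psib n : exists M : R, forall x, `|psi^`(n)%classic x| <= M.
  by apply: smooth_compact_bounded psi0 => //; lra.
pose f j := dilate ratio c psi j; pose g := dilate_lim ratio c psi.
have cpsi : continuous psi by exact: smooth_continuous.
have le12 : (1 : R) <= 2 by lra.
(* The limit stays positive at a maximum point of [psi]. *)
have [t t12 tmax] := EVT_max le12 (continuous_subspaceT cpsi).
have psit : 0 < psi t.
  by rewrite (lt_le_trans _ (tmax (3 / 2) _)) ?bump_on_gt0// ?in_itv/=; lra.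
have psiM y : `|psi y| <= psi t.
  rewrite ger0_norm ?bump_on_ge0//.
  have [/tmax//|/psi0 ->] := boolP (y \in `[1, 2]); exact: ltW.
have fg x : f j x @[j --> \oo] --> g x by exact: dilate_limP psiM.
have f0 j x : x \notin `[1, 4] -> f j x = 0.
  move=> x14; apply: (dilate_eq0 r0 r1 c _ _ psi0) => //.
  apply: contra x14; rewrite !in_itv/= => /andP[-> /=] /le_trans; apply.
  rewrite ler_pdivrMr ?prodr_gt0//.
  by have := prod_ratio_ge j; lra.
have g0 x : x \notin `[1, 4] -> g x = 0.
  move=> x14; apply: cvg_lim => //.
  rewrite (_ : (fun j => _) = cst 0); first exact: cvg_cst.
  by apply/funext => j; exact: f0.
have gpsi x := dilate_lim_dist ratio x hc psiM.
have sf j : smooth (f j) by exact: smooth_dilate.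
have sg : smooth g by exact: smooth_dilate_lim.
exists k, g, (2 * psi t), t; split => //.
  move=> x; rewrite -(subrK (psi x) (g x)) (le_trans (ler_normD _ _))//.
  by have := gpsi x; have := psiM x; rewrite -/g; lra.
split.
  by have := gpsi t; rewrite -/g ler_norml => /andP[+ _]; lra.
move=> i.
have fi j : (i < j)%N -> truncated_moment 8 (k i) (f j) = 0.
  elim: j => // j IH ij.
  have cfj := smooth_continuous (sf j).
  have -> : f j.+1 = fun x => f j x - c j * f j (ratio j * x) by [].
  rewrite truncated_momentB//; last first.
    have := smooth_continuous (smooth_affine (a := ratio j) (b := 0) (sf j)).
    by under [X in continuous X]eq_fun do rewrite addr0.
  have scal : ratio j ^+ (k i).+1 *
      truncated_moment 8 (k i) (fun x => f j (ratio j * x)) =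
      truncated_moment 8 (k i) (f j).
    apply: (truncated_moment_dilation (b := 4)) => //.
    - by have := ratio_ge j; lra.
    - by move=> x x4; apply: f0; rewrite in_itv/= negb_and -!ltNge x4 orbT.
  move: ij; rewrite ltnS leq_eqVlt => /predU1P[ij|ij].
    have -> : c j = ratio j ^+ (k i).+1 by rewrite ij.
    by rewrite scal subrr.
  move: scal; rewrite IH//.
  by move=> /eqP; rewrite mulf_eq0 expf_eq0 gt_eqF//= => /eqP ->; rewrite mulr0 subr0.
have cm : truncated_moment 8 (k i) (f j) @[j --> \oo] -->
    truncated_moment 8 (k i) g.
  apply: (cvg_truncated_moment (M := 2 * psi t)) => // [j||j x].
  - exact: smooth_continuous.
  - exact: smooth_continuous.
  - exact: dilate_bound.
rewrite -(cvg_lim _ cm)//.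
apply: lim_near_cst => //; exists i.+1 => //= j /=; exact: fi.
Qed.

End SparseVanishingMoments.

(** * Measures with a density *)

Section Densities.
Variable R : realType.
Local Notation lambda := (@lebesgue_measure R).
Local Notation borel_measure :=
  {finite_measure set (measurableTypeR R) -> \bar R}.
Implicit Types (f : R -> R) (mu nu : borel_measure).

Lemma density_measure_exists f : measurable_fun [set: R] f ->
  (forall x, 0 <= f x) -> (\int[lambda]_x (f x)%:E < +oo)%E ->
  exists mu : borel_measure, has_density mu f.
Proof.
move=> mf f0 foo.
have mfE : measurable_fun [set: measurableTypeR R] (fun x : R => (f x)%:E).
  exact/measurable_EFinP.
pose m (A : set (measurableTypeR R)) : \bar R := (\int[lambda]_(x in A) (f x)%:E)%E.
have m0 : m set0 = 0%E by rewrite /m integral_set0.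
have mge0 A : (0 <= m A)%E by apply: integral_ge0 => x _; rewrite lee_fin.
have msA : semi_sigma_additive m by exact: semi_sigma_additive_nng_induced.
pose mM := isMeasure.Build _ _ _ m m0 mge0 msA.
pose mm : {measure set (measurableTypeR R) -> \bar R} := HB.pack m mM.
have mfin : fin_num_fun mm by exact: lty_fin_num_fun.
pose mF := Measure_isFinite.Build _ _ _ mm mfin.
pose mu : borel_measure := HB.pack m mM mF.
by exists mu.
Qed.

(** The change of variables formula is known for the Radon-Nikodym derivative,
which agrees with f almost everywhere as both have the same integrals over
measurable sets. *)
Lemma integral_density mu f (h : R -> R) (E : set (measurableTypeR R)) :
  has_density mu f -> measurable_fun [set: R] f ->
  measurable E -> measurable_fun [set: R] h -> (forall x, 0 <= h x) ->
  (\int[mu]_(x in E) (h x)%:E = \int[lambda]_(x in E) (h x * f x)%:E)%E.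
Proof.
move=> [f0 muf] mf mE mh h0.
have mfE : measurable_fun [set: measurableTypeR R] (fun x : R => (f x)%:E).
  exact/measurable_EFinP.
have mhE : measurable_fun [set: measurableTypeR R] (fun x : R => (h x)%:E).
  exact/measurable_EFinP.
have dom : mu `<< lambda.
  apply/null_content_dominatesP => A mA A0; rewrite muf//.
  by apply: null_set_integral => //; exact: measurable_funTS.
rewrite -(Radon_Nikodym_SigmaFinite.change_of_variables dom) => //.
- have RNi := Radon_Nikodym_SigmaFinite.f_integrable dom.
  apply: ae_eq_integral => //.
  + apply: emeasurable_funM; first exact: measurable_funTS.
    by apply: measurable_funTS; exact: measurable_int RNi.
  + apply: measurable_funTS; apply/measurable_EFinP.
    exact: measurable_funM.
  + under [X in ae_eq _ _ _ X]eq_fun do rewrite EFinM.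
    apply: ae_eqe_mul2l; apply: integral_ae_eq => //.
    * exact: integrableS RNi.
    * exact: measurable_funTS.
    * move=> A _ mA; rewrite -muf//.
      by rewrite (Radon_Nikodym_SigmaFinite.f_integral dom).
- exact: measurable_funTS.
Qed.

Lemma moment_density mu f B k : has_density mu f -> continuous f ->
  (forall x, B < x -> f x = 0) -> moment mu k = truncated_moment B k f.
Proof.
move=> muf cf f0; rewrite /moment /truncated_moment /Rintegral; congr fine.
have mf : measurable_fun [set: R] f by exact: continuous_measurable_fun.
(* The integrand of [integral_density] must be nonnegative on the whole line. *)
transitivity (\int[mu]_(t in `[0%R, +oo[) ((`|t| ^+ k)%R)%:E)%E.
  apply: eq_integral => t; rewrite inE/= in_itv/= andbT => t0.
  by rewrite ger0_norm.
rewrite (integral_density (h := fun t => `|t| ^+ k) muf)//; first last.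
- by apply: measurable_funX; exact: normr_measurable.
rewrite [LHS]integral_mkcond [RHS]integral_mkcond; congr integral.
apply/funext => x.
rewrite !patchE !mem_setE !in_itv/= andbT; have [x0/=|//] := leP 0 x.
rewrite ger0_norm//; have [//|Bx] := leP x B.
by rewrite f0// mulr0.
Qed.

Lemma Dco_density mu f (a b : R) : has_density mu f -> 0 < a -> a < b ->
  (forall x, x \notin `[a, b] -> f x = 0) -> @Dco R mu.
Proof.
move=> [f0 muf] a0 ab fab.
have mu0 (A : set (measurableTypeR R)) : measurable A ->
    (forall x, A x -> x \notin `[a, b]) -> mu A = 0%E.
  move=> mA Aab; rewrite muf//; apply: integral0_eq => x Ax.
  by rewrite fab//; exact: Aab.
split.
  apply: mu0 => [|x /= x0]; last first.
    by rewrite in_itv/= negb_and -!ltNge (lt_trans x0 a0).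
  rewrite (_ : [set x | _] = `]-oo, 0%R[%classic); first exact: measurable_itv.
  by apply/seteqP; split => x /=; rewrite in_itv.
exists a, b; split => // x mux; apply/negP => /negP xab.
have oU : open (~` `[a, b]%classic : set R).
  by apply: closed_openC; exact: interval_closed.
have /mux : open_nbhs x (~` `[a, b]%classic : set R) by split=> //; exact/negP.
rewrite mu0 ?ltxx//; last by move=> y /= /negP.
by apply: measurableC; exact: measurable_itv.
Qed.

(** By continuity f exceeds g by a positive constant c on an open interval
around t, and so the two measures of that interval differ by at least c times
its length. *)
Lemma density_lt_not_same_measure mu nu f g t : continuous f -> continuous g ->
  has_density mu f -> has_density nu g -> g t < f t -> ~ same_measure mu nu.
Proof.
move=> cf cg [f0 muf] [g0 nug] gft mn.
pose c := (f t - g t) / 2.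
have c0 : 0 < c by rewrite divr_gt0 ?subr_gt0.
have /cvgrPdist_lt/(_ c c0)[/= d d0 fgd] : f x - g x @[x --> t] --> f t - g t.
  by apply: cvgB; [exact: cf|exact: cg].
pose A : set (measurableTypeR R) := `]t - d, t + d[%classic.
have mA : measurable A by exact: measurable_itv.
have fgA x : A x -> g x + c <= f x.
  rewrite /A/= in_itv/= => /andP[tx xt].
  have := fgd x; rewrite /ball/= ltr_distl => /(_ _)/ltW.
  have -> : (x - d < t < x + d)%R by lra.
  by move=> /(_ isT); rewrite ler_distl /c; lra.
have lA : lambda A = (d *+ 2)%:E.
  rewrite lebesgue_measure_itv/= lte_fin ifT; last lra.
  by rewrite -EFinB; congr EFin; ring.
have mgE : measurable_fun A (fun x : R => (g x)%:E).
  by apply: measurable_funTS; apply/measurable_EFinP; exact: continuous_measurable_fun.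
have mfE : measurable_fun A (fun x : R => (f x)%:E).
  by apply: measurable_funTS; apply/measurable_EFinP; exact: continuous_measurable_fun.
have : (nu A + (c * (d *+ 2))%:E <= mu A)%E.
  rewrite nug// muf// EFinM -lA -integral_cst// -ge0_integralD//=; first last.
  - by move=> x _; rewrite lee_fin ltW.
  - by move=> x _; rewrite lee_fin.
  apply: ge0_le_integral => //=.
  - by move=> x _; rewrite -EFinD lee_fin addr_ge0// ltW.
  - exact: emeasurable_funD.
rewrite mn// leNgt => /negP; apply.
rewrite lteDl; last exact: fin_num_measure.
by rewrite lte_fin; apply: mulr_gt0 => //; rewrite mulrn_wgt0.
Qed.

End Densities.

(** * Two measures with infinitely many common moments *)

Section Counterexample.
Variable R : realType.
Local Notation lambda := (@lebesgue_measure R).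
Local Notation borel_measure :=
  {finite_measure set (measurableTypeR R) -> \bar R}.

Lemma compact_density_measure (f : R -> R) (a b : R) : 0 < a -> a < b ->
  smooth f -> (forall x, 0 <= f x) -> (forall x, x \notin `[a, b] -> f x = 0) ->
  exists mu : borel_measure,
    has_density mu f /\ (@Dco R `&` @has_smooth_density R) mu.
Proof.
move=> a0 ab sf f0 fab.
have cf := smooth_continuous sf.
have [||mu muf] := @density_measure_exists R f _ f0.
- exact: continuous_measurable_fun.
- have fi := @continuous_compact_integrable R f `[a, b]%classic
    (@segment_compact _ a b) (continuous_subspaceT cf).
  have <- : (\int[lambda]_(x in `[a, b]) (f x)%:E = \int[lambda]_x (f x)%:E)%E.
    rewrite integral_mkcond; congr integral; apply/funext => x.
    rewrite patchE mem_setE; case: ifPn => // xab.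
    by rewrite fab.
  rewrite ltey_eq.
  have : (\int[lambda]_(x in `[a, b]) (f x)%:E)%E \is a fin_num.
    exact: (integrable_fin_num _ fi).
  by move=> ->.
exists mu; split => //; split; last by exists f.
exact: Dco_density muf a0 ab fab.
Qed.

(** The densities are [q], a large multiple of a bump that is positive on
[1, 4], and [p = g + q], where g is the function of [sparse_vanishing_moments]:
the multiple is chosen so that [q] dominates the bound of g on [1, 4]. *)
Lemma equal_sparse_moments : exists (k : nat -> nat) (mu nu : borel_measure),
  [/\ forall j, (j <= k j)%N, (@Dco R `&` @has_smooth_density R) mu,
      (@Dco R `&` @has_smooth_density R) nu, ~ same_measure mu nu &
      forall j, moment mu (k j) = moment nu (k j)].
Proof.
have [k [g [M [t [jk sg g0 gM [gt gk]]]]]] := sparse_vanishing_moments R.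
pose chi : R -> R := bump_on (1 / 2) 5.
have schi : smooth chi by exact: smooth_bump_on.
have cchi : continuous chi by exact: smooth_continuous.
have le14 : (1 : R) <= 4 by lra.
have [s s14 smin] := EVT_min le14 (continuous_subspaceT cchi).
have chis : 0 < chi s.
  by apply: bump_on_gt0; move: s14; rewrite in_itv/= => /andP[? ?]; lra.
have M0 : 0 <= M by apply: le_trans (gM 0).
pose C := M / chi s.
have C0 : 0 <= C by rewrite divr_ge0// ltW.
pose q x : R := C * chi x; pose p := g + q.
have sq : smooth q by exact: smoothZ.
have sp : smooth p by exact: smoothD.
have q0 x : 0 <= q x by rewrite mulr_ge0// bump_on_ge0.
have p0 x : 0 <= p x.
  rewrite /p fctE; have [x14|x14] := boolP (x \in `[1, 4]); last first.
    by rewrite g0// add0r.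
  have : M <= q x by rewrite -[leLHS](divfK (lt0r_neq0 chis)) ler_wpM2l// smin.
  by have := gM x; rewrite ler_norml => /andP[+ _]; lra.
have qE x : x \notin `[1 / 2, 5] -> q x = 0.
  move=> xab; rewrite /q /chi bump_on_eq0 ?mulr0//; apply: contra xab.
  by rewrite in_itv/= => /andP[? ?]; lra.
have pE x : x \notin `[1 / 2, 5] -> p x = 0.
  move=> xab; rewrite /p fctE qE// addr0 g0//; apply: contra xab.
  by rewrite !in_itv/= => /andP[? ?]; lra.
have a0 : (0 : R) < 1 / 2 by lra.
have ab : (1 / 2 : R) < 5 by lra.
have [mu [muq muD]] := compact_density_measure a0 ab sp p0 pE.
have [nu [nup nuD]] := compact_density_measure a0 ab sq q0 qE.
have cp := smooth_continuous sp; have cq := smooth_continuous sq.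
exists k, mu, nu; split => //.
  apply: (density_lt_not_same_measure (t := t) cp cq) => //.
  by rewrite /p fctE ltrDr.
have E0 (h : R -> R) : (forall x, x \notin `[1 / 2, 5] -> h x = 0) ->
    forall x, 8 < x -> h x = 0.
  by move=> hE x x8; apply: hE; rewrite in_itv/= negb_and -!ltNge; lra.
move=> j; rewrite (moment_density _ muq cp (E0 _ pE)).
rewrite (moment_density _ nup cq (E0 _ qE)).
have := truncated_momentB 8 (k j) 1 cp cq.
have -> : (fun x => p x - 1 * q x) = g.
  by apply/funext => x; rewrite mul1r /p fctE addrK.
by rewrite gk mul1r => /esym/eqP; rewrite subr_eq0 => /eqP.
Qed.

End Counterexample.

(** * An ultrafilter containing a sparse set *)

(** Extend to an ultrafilter the image of the Frechet filter under k.  It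
contains all cofinite sets, because k tends to infinity, and so it is not
principal. *)
Lemma ultrafilter_along (k : nat -> nat) : (forall j, (j <= k j)%N) ->
  exists (F : set_system nat) (FF : UltraFilter F), nonprincipal F /\ F (range k).
Proof.
move=> jk.
have [F [FF kF]] := ultraFilterLemma (fmap_proper_filter k (eventually_filter)).
exists F, FF; split; last by apply: kF; exists 0%N => // j _; exists j.
move=> n Fn.
have Fgt : F [set m | (n < m)%N].
  by apply: kF; exists n.+1 => // j /= nj; exact: leq_trans nj (jk j).
by move: Fgt; rewrite Fn => /principal_filterP /=; rewrite ltnn.
Qed.

Theorem proposition5 (R : realType) :
  exists (F : set_system nat) (FF : UltraFilter F),
    [/\ nonprincipal F,
        ~ injective_on (@Dco R) (@Phi R F FF)
      & ~ injective_on (@Dco R `&` @has_smooth_density R) (@Phi R F FF)].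
Proof.
have [k [mu [nu [jk muD nuD mun munu]]]] := equal_sparse_moments R.
have [F [FF [nF Fk]]] := ultrafilter_along jk.
have PhiE : Phi F mu = Phi F nu.
  by apply/hyperclassP; apply: filterS Fk => _ [j _ <-] /=.
exists F, FF; split => // inj; apply: mun; apply: inj => //.
- by case: muD.
- by case: nuD.
Qed.
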